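(* Let $h>0$, let $\overline\nabla\phi$ be a discrete gradient of $\phi$, and let $(\mathbf{x}^n)_{n\ge0}$ be a numerical solution of the discrete-gradient leapfrog method, i.e. for all $n\ge1$ $$\mathbf{M}\,\frac{\mathbf{x}^{n+1}-2\mathbf{x}^n+\mathbf{x}^{n-1}}{h^2}=\overline{\mathbf{F}}^n\,\frac{\mathbf{x}^{n+1}-\mathbf{x}^{n-1}}{2h}.$$ Then the method preserves both the mass shell $\mathcal{H}(\mathbf{u})=\tfrac12\mathbf{u}^\top\mathbf{M}\mathbf{u}$ and the energy $H(x,\gamma)=\gamma+\phi(x)$: for all $n$, $$\mathcal{H}\bigl(\mathbf{u}^{n+1/2}\bigr)=\mathcal{H}\bigl(\mathbf{u}^{1/2}\bigr),\qquad H\bigl(x^{n+1/2},\gamma^{n+1/2}\bigr)=H\bigl(x^{1/2},\gamma^{1/2}\bigr).$$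
   Context: Let $\phi:\mathbb{R}^3\to\mathbb{R}$ and $A:\mathbb{R}^3\to\mathbb{R}^3$ be arbitrarily differentiable, $B(x)=\nabla\times A(x)$, and let $\widehat B(x)$ be the $3\times3$ matrix with $\widehat B(x)v=B(x)\times v$ for all $v\in\mathbb{R}^3$. A discrete gradient of $\phi$ is a continuous map $\overline\nabla\phi:\mathbb{R}^3\times\mathbb{R}^3\to\mathbb{R}^3$ such that for all $x,\widehat x\in\mathbb{R}^3$: $\overline\nabla\phi(\widehat x,x)\cdot(\widehat x-x)=\phi(\widehat x)-\phi(x)$ and $\overline\nabla\phi(x,x)=\nabla\phi(x)$. Notation: $\mathbf{M}=\mathrm{diag}(-1,1,1,1)$; $\mathbf{x}^n=(t^n;x^n)\in\mathbb{R}\times\mathbb{R}^3$; $x^{n\pm1/2}=\tfrac12(x^n+x^{n\pm1})$; $\mathbf{u}^{n+1/2}=(\gamma^{n+1/2};u^{n+1/2})=(\mathbf{x}^{n+1}-\mathbf{x}^n)/h\in\mathbb{R}\times\mathbb{R}^3$; and $$\overline{\mathbf{F}}^n=\begin{pmatrix}0&(\overline\nabla\phi^n)^\top\\-\overline\nabla\phi^n&-\widehat B(x^n)\end{pmatrix},\qquad \overline\nabla\phi^n=\overline\nabla\phi(x^{n+1/2},x^{n-1/2}).$$ Equivalently, in one-step form, $\mathbf{M}(\mathbf{u}^{n+1/2}-\mathbf{u}^{n-1/2})=\tfrac h2\overline{\mathbf{F}}^n(\mathbf{u}^{n+1/2}+\mathbf{u}^{n-1/2})$ and $\mathbf{x}^{n+1}=\mathbf{x}^n+h\mathbf{u}^{n+1/2}$.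 *)

(* Defs.v *)
From mathcomp Require Import all_boot all_order all_algebra.
From mathcomp Require Import all_classical all_reals all_analysis.
From mathcomp Require Import ring.

Set Implicit Arguments.
Unset Strict Implicit.
Unset Printing Implicit Defensive.

Import Order.TTheory GRing.Theory Num.Theory.
Import numFieldNormedType.Exports.

Local Open Scope ring_scope.

Definition dot (R : realType) (d : nat) (v w : 'cV[R]_d) : R :=
  (v^T *m w) 0 0.

Definition vec3 (R : realType) (a b c : R) : 'cV[R]_3 :=
  \col_i [:: a; b; c]`_i.

(* Coordinates are numbered 0, 1, 2. *)
Definition ax0 : 'I_3 := @Ordinal 3 0 isT.
Definition ax1 : 'I_3 := @Ordinal 3 1 isT.
Definition ax2 : 'I_3 := @Ordinal 3 2 isT.

Definition cross (R : realType) (b v : 'cV[R]_3) : 'cV[R]_3 :=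
  vec3 (b ax1 0 * v ax2 0 - b ax2 0 * v ax1 0)
       (b ax2 0 * v ax0 0 - b ax0 0 * v ax2 0)
       (b ax0 0 * v ax1 0 - b ax1 0 * v ax0 0).

Definition hat (R : realType) (b : 'cV[R]_3) : 'M[R]_3 :=
  \matrix_(i, j) (nth [::] [:: [::        0; - b ax2 0;   b ax1 0];
                              [::   b ax2 0;        0; - b ax0 0];
                              [:: - b ax1 0;   b ax0 0;        0]] i)`_j.

Lemma hatE (R : realType) (b v : 'cV[R]_3) : hat b *m v = cross b v.
Proof.
apply/colP => i; rewrite !mxE !big_ord_recl big_ord0 !mxE /=.
have -> : v 0 0 = v ax0 0 by congr (v _ _); apply: val_inj.
have -> : v (lift ord0 ord0) 0 = v ax1 0 by congr (v _ _); apply: val_inj.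
have -> : v (lift ord0 (lift ord0 ord0)) 0 = v ax2 0.
  by congr (v _ _); apply: val_inj.
by case: i => [[|[|[|//]]] ?] /=; ring.
Qed.

Definition partial (R : realType) (W : normedModType R) (i : 'I_3)
    (f : 'cV[R]_3 -> W) : 'cV[R]_3 -> W :=
  fun x => 'D_(delta_mx i 0) f x.

(* All iterated partial derivatives, of every order and in every sequence of
   directions, exist and are Frechet differentiable everywhere; since
   differentiability entails continuity, this is C^infinity. *)
Definition smooth (R : realType) (W : normedModType R)
    (f : 'cV[R]_3 -> W) : Prop :=
  forall (s : seq 'I_3) (x : 'cV[R]_3),
    differentiable (foldr (@partial R W) f s) x.

Definition grad (R : realType) (phi : 'cV[R]_3 -> R) (x : 'cV[R]_3) :
    'cV[R]_3 :=
  \col_i partial i phi x.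

Definition curl (R : realType) (A : 'cV[R]_3 -> 'cV[R]_3) (x : 'cV[R]_3) :
    'cV[R]_3 :=
  let d i j := partial i (fun y => A y j 0) x in
  vec3 (d ax1 ax2 - d ax2 ax1) (d ax2 ax0 - d ax0 ax2) (d ax0 ax1 - d ax1 ax0).

Definition discrete_gradient (R : realType) (phi : 'cV[R]_3 -> R)
    (dphi : 'cV[R]_3 -> 'cV[R]_3 -> 'cV[R]_3) : Prop :=
  [/\ continuous (fun p : 'cV[R]_3 * 'cV[R]_3 => dphi p.1 p.2),
      forall xh x, dot (dphi xh x) (xh - x) = phi xh - phi x
    & forall x, dphi x x = grad phi x].

(* A space-time vector (t; x) has type 'cV_(1 + 3), with blocks t and x. *)
Definition time_part (R : realType) (X : 'cV[R]_(1 + 3)) : R := usubmx X 0 0.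
Definition space_part (R : realType) (X : 'cV[R]_(1 + 3)) : 'cV[R]_3 := dsubmx X.

Definition lorentz_metric (R : realType) : 'M[R]_(1 + 3) :=
  diag_mx (row_mx (const_mx (- 1)) (const_mx 1)).

(* Half-integer indices are rounded down: [half_pos X n] is x^{n+1/2} and
   [half_vel h X n] is (gamma^{n+1/2}; u^{n+1/2}), so x^{n-1/2} is
   [half_pos X n.-1] for n >= 1. *)
Definition half_pos (R : realType) (X : nat -> 'cV[R]_(1 + 3)) (n : nat) :
    'cV[R]_3 :=
  2^-1 *: (space_part (X n) + space_part (X n.+1)).

Definition half_vel (R : realType) (h : R) (X : nat -> 'cV[R]_(1 + 3))
    (n : nat) : 'cV[R]_(1 + 3) :=
  h^-1 *: (X n.+1 - X n).

Definition dg_field (R : realType) (A : 'cV[R]_3 -> 'cV[R]_3)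
    (dphi : 'cV[R]_3 -> 'cV[R]_3 -> 'cV[R]_3)
    (X : nat -> 'cV[R]_(1 + 3)) (n : nat) : 'M[R]_(1 + 3) :=
  let g := dphi (half_pos X n) (half_pos X n.-1) in
  block_mx 0   g^T
           (- g) (- hat (curl A (space_part (X n)))).

Definition dg_leapfrog (R : realType) (h : R) (A : 'cV[R]_3 -> 'cV[R]_3)
    (dphi : 'cV[R]_3 -> 'cV[R]_3 -> 'cV[R]_3)
    (X : nat -> 'cV[R]_(1 + 3)) : Prop :=
  forall n : nat, (1 <= n)%N ->
    lorentz_metric R *m ((h ^+ 2)^-1 *: (X n.+1 - 2 *: X n + X n.-1)) =
    dg_field A dphi X n *m ((2 * h)^-1 *: (X n.+1 - X n.-1)).

Definition mass_shell (R : realType) (u : 'cV[R]_(1 + 3)) : R :=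
  2^-1 * (u^T *m lorentz_metric R *m u) 0 0.

Definition energy (R : realType) (phi : 'cV[R]_3 -> R) (x : 'cV[R]_3)
    (gamma : R) : R :=
  gamma + phi x.

(* Main.v *)
(** One step of the method reads M (v - u) = (h/2) F (v + u) for consecutive
    velocities u and v.  Pairing it with v + u gives the mass shell, since F is
    skew-symmetric.  Its time component gives the energy: the space part of
    (h/2) (v + u) is the difference of the midpoint positions, on which the
    discrete gradient returns the exact increment of phi. *)

Require Import Defs.
From mathcomp Require Import all_boot all_order all_algebra.
From mathcomp Require Import all_classical all_reals all_analysis.
From mathcomp Require Import ring lra.

Set Implicit Arguments.
Unset Strict Implicit.
Unset Printing Implicit Defensive.

Import Order.TTheory GRing.Theory Num.Theory.
Import numFieldNormedType.Exports.

Local Open Scope ring_scope.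

Lemma trmx_hat (R : realType) (b : 'cV[R]_3) : (hat b)^T = - hat b.
Proof.
apply/matrixP => i j; rewrite !mxE.
by case: i j => [[|[|[|//]]] ?] [[|[|[|//]]] ?] /=; rewrite ?opprK ?oppr0.
Qed.

(** A scalar equals its own transpose, while skewness makes transposition flip its sign. *)
Lemma quad_skew (R : realType) (d : nat) (F : 'M[R]_d) (w : 'cV[R]_d) :
  F^T = - F -> (w^T *m F *m w) 0 0 = 0.
Proof.
move=> skewF.
have : (w^T *m F *m w)^T 0 0 = - (w^T *m F *m w) 0 0.
  by rewrite !trmx_mul trmxK skewF mulNmx mulmxN mulmxA mxE.
by rewrite mxE; lra.
Qed.

Lemma trmx_dg_field (R : realType) (A : 'cV[R]_3 -> 'cV[R]_3)
    (dphi : 'cV[R]_3 -> 'cV[R]_3 -> 'cV[R]_3) (X : nat -> 'cV[R]_(1 + 3))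
    (n : nat) :
  (dg_field A dphi X n)^T = - dg_field A dphi X n.
Proof.
rewrite /dg_field; set g := dphi _ _.
rewrite tr_block_mx opp_block_mx trmx0 oppr0 trmxK opprK !linearN /=.
by rewrite trmx_hat.
Qed.

Lemma trmx_lorentz_metric (R : realType) :
  (lorentz_metric R)^T = lorentz_metric R.
Proof. exact: tr_diag_mx. Qed.

(** The second difference of [X] is a first difference of velocities, and the centred difference is
    their mean; multiplying by [h] clears the remaining denominator. *)
Lemma dg_leapfrog_one_step (R : realType) (h : R)
    (A : 'cV[R]_3 -> 'cV[R]_3) (dphi : 'cV[R]_3 -> 'cV[R]_3 -> 'cV[R]_3)
    (X : nat -> 'cV[R]_(1 + 3)) (n : nat) :
  h != 0 -> dg_leapfrog h A dphi X ->
  lorentz_metric R *m (half_vel h X n.+1 - half_vel h X n) =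
  (h / 2) *: (dg_field A dphi X n.+1 *m (half_vel h X n.+1 + half_vel h X n)).
Proof.
move=> h_neq0 /(_ n.+1 isT) /=.
have -> : (h ^+ 2)^-1 *: (X n.+2 - 2 *: X n.+1 + X n) =
    h^-1 *: (half_vel h X n.+1 - half_vel h X n).
  by apply/matrixP => i j; rewrite !mxE; field.
have -> : (2 * h)^-1 *: (X n.+2 - X n) =
    2^-1 *: (half_vel h X n.+1 + half_vel h X n).
  by apply/matrixP => i j; rewrite !mxE; field.
rewrite -!scalemxAr => /(congr1 (fun w => h *: w)).
by rewrite /= !scalerA divff // scale1r.
Qed.

(** Difference of squares for a quadratic form: the mixed terms cancel because the metric is
    symmetric. *)
Lemma mass_shellB (R : realType) (u v : 'cV[R]_(1 + 3)) :
  mass_shell v - mass_shell u =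
  2^-1 * ((v + u)^T *m (lorentz_metric R *m (v - u))) 0 0.
Proof.
have sym : (v^T *m lorentz_metric R *m u) 0 0 =
    (u^T *m lorentz_metric R *m v) 0 0.
  transitivity ((v^T *m lorentz_metric R *m u)^T 0 0); first by rewrite [RHS]mxE.
  by rewrite !trmx_mul trmxK trmx_lorentz_metric mulmxA.
have addE (M N : 'M[R]_1) : (M + N) 0 0 = M 0 0 + N 0 0 by rewrite mxE.
have oppE (M : 'M[R]_1) : (- M) 0 0 = - M 0 0 by rewrite mxE.
rewrite /mass_shell mulmxA [(v + u)^T]linearD /= !mulmxDl !mulmxBr.
by rewrite !addE !oppE sym; ring.
Qed.

Lemma time_part_lorentz_metric (R : realType) (u : 'cV[R]_(1 + 3)) :
  time_part (lorentz_metric R *m u) = - time_part u.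
Proof.
rewrite /time_part /lorentz_metric mul_diag_mx [LHS]mxE [LHS]mxE row_mxEl.
by rewrite !mxE mulN1r.
Qed.

(** The top block row of the field is [(0, g^T)], so the magnetic block does not enter. *)
Lemma time_part_dg_field (R : realType) (A : 'cV[R]_3 -> 'cV[R]_3)
    (dphi : 'cV[R]_3 -> 'cV[R]_3 -> 'cV[R]_3) (X : nat -> 'cV[R]_(1 + 3))
    (n : nat) (w : 'cV[R]_(1 + 3)) :
  time_part (dg_field A dphi X n *m w) =
  dot (dphi (half_pos X n) (half_pos X n.-1)) (space_part w).
Proof.
rewrite /time_part /dg_field -{1}[w]vsubmxK mul_block_col col_mxKu mul0mx.
by rewrite add0r.
Qed.

(** Both midpoints share the node [X n.+1], which cancels and leaves half of [X n.+2 - X n]. *)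
Lemma half_posB (R : realType) (h : R) (X : nat -> 'cV[R]_(1 + 3)) (n : nat) :
  h != 0 ->
  half_pos X n.+1 - half_pos X n =
  (h / 2) *: space_part (half_vel h X n.+1 + half_vel h X n).
Proof. by move=> h_neq0; apply/matrixP => i j; rewrite !mxE; field. Qed.

Theorem theorem4p1 (R : realType)
    (phi : 'cV[R]_3 -> R) (phi_smooth : smooth phi)
    (A : 'cV[R]_3 -> 'cV[R]_3) (A_smooth : smooth A)
    (h : R) (h_gt0 : 0 < h)
    (dphi : 'cV[R]_3 -> 'cV[R]_3 -> 'cV[R]_3)
    (dphi_dg : discrete_gradient phi dphi)
    (X : nat -> 'cV[R]_(1 + 3)) (X_sol : dg_leapfrog h A dphi X) :
  forall n : nat,
    mass_shell (half_vel h X n) = mass_shell (half_vel h X 0) /\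
    energy phi (half_pos X n) (time_part (half_vel h X n)) =
    energy phi (half_pos X 0) (time_part (half_vel h X 0)).
Proof.
have h_neq0 : h != 0 by rewrite gt_eqF.
have [_ dphi_incr _] := dphi_dg.
(* Rewriting the initial values back to those at [n] leaves conservation across a single step. *)
elim=> [//|n [<- <-]].
have step := dg_leapfrog_one_step n h_neq0 X_sol.
split; apply/eqP; rewrite -subr_eq0; apply/eqP.
  rewrite mass_shellB step -scalemxAr mxE mulmxA quad_skew ?mulr0 //.
  exact: trmx_dg_field.
have := congr1 (@time_part R) step.
rewrite time_part_lorentz_metric.
have -> (a : R) w : time_part (a *: w) = a * time_part w.
  by rewrite /time_part linearZ mxE.
have -> u v : time_part (u - v) = time_part u - time_part v :> R.
  by rewrite /time_part linearB !mxE.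
(* The increment of [phi] becomes [h / 2] times the pairing that the time component of [step]
   equates with minus the increment of gamma. *)
have := dphi_incr (half_pos X n.+1) (half_pos X n).
rewrite time_part_dg_field (half_posB _ _ h_neq0) /dot -scalemxAr mxE /energy.
by move=> -> ; lra.
Qed.
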